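(* For any integer $d \geq 2$ and any integer $n \geq d+2$, $V(n,d)\neq\emptyset$ if and only if $2 \mid \binom{n}{d}$.
   Context: Let $K$ be a field, $S=K[x_1,\ldots,x_n]$ and $[n]=\{1,\ldots,n\}$. For a square-free monomial $u$, let $\sigma(u)=\{i\in[n] \mid x_i\mid u\}$. For a square-free monomial ideal $I$ of $S$ with minimal monomial generating set $G(I)$, the facet complex $\delta_{\mathcal F}(I)$ is the simplicial complex generated by the sets $\sigma(u)$, $u\in G(I)$ (i.e. all subsets of these sets), and the Stanley–Reisner complex is $\delta_{\mathcal N}(I)=\{\sigma(g) \mid g \text{ a square-free monomial of } S,\ g\notin I\}$. The ideal $I$ is called an $f$-ideal if $\delta_{\mathcal F}(I)$ and $\delta_{\mathcal N}(I)$ have the same $f$-vector (the same number of faces in each dimension). A square-free monomial ideal is of degree $d$ if it is nonzero and all elements of $G(I)$ have degree $d$. $V(n,d)$ denotes the set of $f$-ideals of degree $d$ in $S=K[x_1,\ldots,x_n]$. *)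

(* Defs.v *)
From mathcomp Require Import all_boot all_order all_algebra.
From mathcomp Require Import boolp classical_sets.
From mathcomp Require Import mpoly.

Set Implicit Arguments.
Unset Strict Implicit.
Unset Printing Implicit Defensive.

Import GRing.Theory.

Local Open Scope ring_scope.

(* The ring S = K[x_1, ..., x_n] is {mpoly K[n]}; a monomial x^m is given by
   its exponent vector m : 'X_{1..n}, and is 'X_[m] as an element of S.  Ideals
   of S are subsets in the sense of classical_sets, i.e. Prop predicates. *)

Section FIdeals.
Variables (K : fieldType) (n : nat).
Local Notation S := {mpoly K[n]}.
Local Notation mon := 'X_{1..n}.

(* The unit ideal is allowed, unlike in ring_quotient.idealr_closed. *)
Definition is_ideal (I : set S) : Prop :=
  [/\ I 0, forall p q, I p -> I q -> I (p + q) & forall a p, I p -> I (a * p)].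

Definition monomial_ideal (G : set mon) : set S :=
  smallest is_ideal (image G (fun m => 'X_[m])).

Definition squarefree (m : mon) : bool := [forall i, m i <= 1]%N.

Definition sigma (m : mon) : {set 'I_n} := [set i | (0 < m i)%N]%SET.

Definition squarefree_monomial_ideal (I : set S) : Prop :=
  exists G : set mon, (forall m, G m -> squarefree m) /\ I = monomial_ideal G.

Definition minimal_generating (I : set S) (G : set mon) : Prop :=
  monomial_ideal G = I /\
  forall G' : set mon, subset G' G -> monomial_ideal G' = I -> G' = G.

(* G(I).  A monomial ideal has exactly one minimal generating set of monomials,
   see mingensP and minimal_generating_unique below. *)
Definition mingens (I : set S) : set mon :=
  fun u => exists G, minimal_generating I G /\ G u.

Definition facet_complex (I : set S) : {set {set 'I_n}} :=
  [set A : {set 'I_n} | `[< exists u, mingens I u /\ A \subset sigma u >]]%SET.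

Definition SR_complex (I : set S) : {set {set 'I_n}} :=
  [set A : {set 'I_n} |
    `[< exists g : mon, [/\ squarefree g, ~ I 'X_[g] & A = sigma g] >]]%SET.

(* Entry k of the f-vector counts the faces with k vertices, i.e. those of
   dimension k - 1; k = 0 is the empty face. *)
Definition fvector (D : {set {set 'I_n}}) (k : nat) : nat :=
  #|[set A in D | #|A| == k]%SET|.

Definition f_ideal (I : set S) : Prop :=
  squarefree_monomial_ideal I /\
  forall k, fvector (facet_complex I) k = fvector (SR_complex I) k.

Definition of_degree (d : nat) (I : set S) : Prop :=
  (exists2 p, I p & p != 0) /\ forall u, mingens I u -> mdeg u = d.

Definition V (d : nat) : set (set S) := fun I => f_ideal I /\ of_degree d I.

Lemma monomial_idealP (G : set mon) (m : mon) :
  monomial_ideal G 'X_[m] <-> exists2 g, G g & (g <= m)%MM.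
Proof.
split=> [h | [g Gg le_gm] J [[_ _ JM] JG]]; last first.
  rewrite -(submK le_gm) mpolyXD; apply: JM; apply: JG.
  by exists g.
pose J := fun p : S =>
  forall u, u \in msupp p -> exists2 g, G g & (g <= u)%MM.
suff Jm : J 'X_[m] by apply: Jm; rewrite msuppX inE eqxx.
apply: (h J); split=> [|_ [g Gg <-] u]; last first.
  by rewrite msuppX inE => /eqP->; exists g; rewrite ?lepm_refl.
split=> [u|p q Jp Jq u|a p Jp u]; first by rewrite msupp0.
  by move/msuppD_le; rewrite mem_cat => /orP[/Jp|/Jq].
case/msuppM_le/allpairsP=> -[u1 u2] /= [_ /Jp[g Gg le_g] ->].
by exists g => //; apply: lepm_trans le_g (lem_addl _ _).
Qed.

Lemma monomial_ideal_ideal (G : set mon) : is_ideal (monomial_ideal G).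
Proof.
split=> [J [[]//]|p q hp hq J hJ|a p hp J hJ].
  by have [[_ JD _] _] := hJ; apply: JD; [apply: hp|apply: hq].
by have [[_ _ JM] _] := hJ; apply: JM; apply: hp.
Qed.

Lemma monomial_ideal_sub (G H : set mon) :
  (forall h, H h -> monomial_ideal G 'X_[h]) ->
  subset (monomial_ideal H) (monomial_ideal G).
Proof.
move=> HG p; apply; split; first exact: monomial_ideal_ideal.
by move=> _ [h Hh <-]; apply: HG.
Qed.

Lemma minimal_generatingE (H G : set mon) (I := monomial_ideal H) :
  minimal_generating I G <->
  G = fun m => I 'X_[m] /\ forall v, I 'X_[v] -> (v <= m)%MM -> v = m.
Proof.
split=> [[GI minG] | ->{G}].
  have GIX u : G u -> I 'X_[u].
    by move=> Gu; rewrite -GI; apply/monomial_idealP; exists u; rewrite ?lepm_refl.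
  apply/seteqP; split=> [g Gg | m [Im minm]]; last first.
    move: (Im); rewrite -GI => /monomial_idealP[g Gg le_gm].
    by rewrite -(minm g) //; apply: GIX.
  split=> [|v Iv le_vg]; first exact: GIX.
  move: Iv; rewrite -GI => /monomial_idealP[g' Gg' le_g'v].
  suff eg : g' = g.
    apply/mnmP=> i; apply/eqP; rewrite eqn_leq (mnm_lepP le_vg).
    by rewrite -eg (mnm_lepP le_g'v).
  apply: contrapT => ne_g.
  suff EG: (fun u => G u /\ u <> g) = G by move: Gg; rewrite -{1}EG => -[].
  apply: minG; first by move=> u [].
  rewrite -GI; apply/seteqP; split; apply: monomial_ideal_sub => u.
    by case=> Gu _; apply/monomial_idealP; exists u; rewrite ?lepm_refl.
  move=> Gu; apply/monomial_idealP.
  have [->|/eqP ne_u] := eqVneq u g; last by exists u; rewrite ?lepm_refl.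
  by exists g' => //; apply: lepm_trans le_vg.
set G := fun m => _; split.
  apply/seteqP; split; first by move=> p; apply; split;
    [exact: monomial_ideal_ideal | move=> _ [m [Im _] <-]].
  apply: monomial_ideal_sub => h Hh.
  have Ih : I 'X_[h] by apply/monomial_idealP; exists h; rewrite ?lepm_refl.
  apply/monomial_idealP; move: {2}(mdeg h) (leqnn (mdeg h)) => k.
  elim: k h Ih {Hh} => [|k IHk] h Ih le_hk;
    (have [Gh | nGh] := pselect (G h); first by exists h; rewrite ?lepm_refl).
    case: nGh; split=> // v _ le_vh; apply/mnmP=> i.
    have h0 : h = 0%MM by apply/eqP; rewrite -mdeg_eq0 -leqn0.
    by move/mnm_lepP: le_vh => /(_ i); rewrite h0 mnm0E leqn0 => /eqP.
  have [v [Iv le_vh ne_v]] : exists v, [/\ I 'X_[v], (v <= h)%MM & v <> h].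
    apply: contrapT => nv; apply: nGh; split=> // v Iv le_vh.
    by apply: contrapT => ne_v; apply: nv; exists v.
  have [] := IHk v Iv; last first.
    by move=> g Gg le_gv; exists g => //; apply: lepm_trans le_vh.
  rewrite -ltnS; apply: leq_trans le_hk.
  have hE := submK le_vh; rewrite -[in ltnRHS]hE mdegD.
  rewrite -[ltnLHS]add0n ltn_add2r lt0n.
  apply/eqP=> /eqP; rewrite mdeg_eq0 => /eqP d0.
  by apply: ne_v; rewrite -hE d0 add0m.
move=> G' sG' IG'; apply/seteqP; split=> // m [Im minm].
move: (Im); rewrite -IG' => /monomial_idealP[g Gg le_gm].
by rewrite -(minm g) //; have [] := sG' _ Gg.
Qed.

Lemma minimal_generating_unique (I : set S) (G1 G2 : set mon) :
  squarefree_monomial_ideal I ->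
  minimal_generating I G1 -> minimal_generating I G2 -> G1 = G2.
Proof.
by case=> H [_ ->] /minimal_generatingE-> /minimal_generatingE->.
Qed.

Lemma mingensP (I : set S) :
  squarefree_monomial_ideal I -> minimal_generating I (mingens I).
Proof.
move=> sI; have [H [_ IE]] := sI.
have [G mG] : exists G, minimal_generating I G.
  by rewrite IE; eexists; apply/minimal_generatingE; reflexivity.
suff -> : mingens I = G by [].
apply/seteqP; split=> [u [G' [mG' G'u]]|u Gu]; last by exists G.
by rewrite (minimal_generating_unique sI mG mG').
Qed.

End FIdeals.

Arguments V : clear implicits.

(* Main.v *)
(* Let A be the family of supports of the generators of an ideal of degree d.
   The faces of size d are A in the facet complex and the remaining d-subsets in
   the Stanley-Reisner complex, so an f-ideal has 2 |A| = 'C(n, d).  In the other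
   sizes the two f-vectors agree as soon as A is perfect: every (d+1)-set contains
   a member of A and every (d-1)-set lies in one.  Perfection is preserved when A
   grows, so it suffices to find a perfect family with 2 |A| <= 'C(n, d).  If A1
   and A2 are perfect for (n-1, d) and (n-1, d-1), then A1 together with the sets
   F + n, F in A2, is perfect for (n, d), and the bounds add up by Pascal's rule.
   The induction starts at d = 2, with two disjoint cliques of nearly equal size,
   and at n = d + 2, where complementation reduces to d = 2. *)
Require Import Defs.
From mathcomp Require Import all_boot all_order all_algebra.
From mathcomp Require Import boolp classical_sets.
From mathcomp Require Import mpoly.
From mathcomp Require Import zify.

Set Implicit Arguments.
Unset Strict Implicit.
Unset Printing Implicit Defensive.

(** Among the pairs of an [n]-set cut into halves, those across the cut outnumber those within a
    half by [n./2]. *)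
Lemma bin2_halves n : 2 * ('C(n./2, 2) + 'C(n - n./2, 2)) <= 'C(n, 2).
Proof.
have b2 m : 2 * 'C(m, 2) = m * m.-1.
  rewrite mul2n bin2 -[RHS]odd_double_half oddM.
  by case: m => //= m; rewrite andNb.
move: (odd_double_half n); move: (odd n) n./2 => b a <-.
have -> : b + a.*2 - a = a + b by lia.
have := (b2 a, b2 (a + b), b2 (b + a.*2)) => -[[]].
by case: b; case: a => [|c] /=; rewrite ?addn0 ?addn1 /=; nia.
Qed.

Lemma ex_card_between (T : finType) (B V : {set T}) k :
  B \subset V -> #|B| <= k <= #|V| ->
  exists E : {set T}, [/\ B \subset E, E \subset V & #|E| = k].
Proof.
move=> sBV /andP[leBk lekV].
have cD := cardsDS sBV.
have : 0 < #|[set E : {set T} | E \subset V :\: B & #|E| == k - #|B|]|.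
  by rewrite cards_draws bin_gt0 cD leq_sub2r.
case/card_gt0P=> E; rewrite inE finset.subsetD => /andP[/andP[sEV dEB] /eqP cE].
exists (B :|: E); rewrite finset.subsetUl finset.subUset sBV sEV; split=> //.
have := cardsUI B E.
by rewrite disjoint_setI0 1?disjoint_sym // cards0 addn0 cE subnKC.
Qed.

(** * Perfect families of subsets of a finite set *)

Section PerfectFamilies.
Variable T : finType.
Implicit Types (V B D E F : {set T}) (A : {set {set T}}).

Definition upper_cover V d A : Prop :=
  forall D, D \subset V -> #|D| = d.+1 -> exists2 F, F \in A & F \subset D.

(** Writing [#|E|.+1 = d] instead of a predecessor makes the condition vacuous at [d = 0]. *)
Definition lower_cover V d A : Prop :=
  forall E, E \subset V -> #|E|.+1 = d -> exists2 F, F \in A & E \subset F.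

(** The ground set [V] is a parameter, so that the induction can delete a point without changing the
    type [T]. *)
Definition perfect V d A : Prop :=
  [/\ A \subset [set F : {set T} | F \subset V & #|F| == d],
      upper_cover V d A & lower_cover V d A].

Lemma perfect_mem V d A F :
  perfect V d A -> F \in A -> F \subset V /\ #|F| = d.
Proof.
by case=> /fintype.subsetP sA _ _ /sA; rewrite inE => /andP[sFV /eqP].
Qed.

Lemma perfect_sup V d A A' :
    perfect V d A -> A \subset A' ->
    A' \subset [set F : {set T} | F \subset V & #|F| == d] ->
  perfect V d A'.
Proof.
move=> [_ upA loA] /fintype.subsetP sAA' sA'; split=> // [D sD cD|E sE cE].
  by have [F /sAA' ? ?] := upA _ sD cD; exists F.
by have [F /sAA' ? ?] := loA _ sE cE; exists F.
Qed.

(** Cut [V] into [P] and [V :\: P] and take the pairs inside either part. Of three points two share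
    a part, and with [4 <= #|V|] each part has a second point to complete a singleton. *)
Lemma perfect_pairs V : 4 <= #|V| ->
  exists2 A, perfect V 2 A & 2 * #|A| <= 'C(#|V|, 2).
Proof.
move=> V4.
have [||P [_ sPV cP]] := @ex_card_between T finset.set0 V #|V|./2.
- exact: finset.sub0set.
- by rewrite cards0 /=; lia.
have cQ : #|V :\: P| = #|V| - #|V|./2 by rewrite cardsDS // cP.
pose pairs B := [set F : {set T} | F \subset B & #|F| == 2].
have in_part x : x \in V -> exists2 B, B = P \/ B = V :\: P & x \in B.
  move=> xV; have [xP|xP] := boolP (x \in P); first by exists P; [left|].
  by exists (V :\: P); [right|rewrite inE xP].
have pairsU B F : B = P \/ B = V :\: P -> F \in pairs B ->
    F \in pairs P :|: pairs (V :\: P).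
  by case=> ->; rewrite [in X in _ -> X]inE => ->; rewrite ?orbT.
exists (pairs P :|: pairs (V :\: P)); first split.
- apply/fintype.subsetP=> F; rewrite !inE => /orP[]/andP[sF ->]; rewrite andbT.
    exact: (fintype.subset_trans sF sPV).
  exact: (fintype.subset_trans sF (finset.subsetDl _ _)).
- move=> D sDV cD.
  have [B eB cB] : exists2 B, B = P \/ B = V :\: P & 2 <= #|D :&: B|.
    have := cardsID P D; rewrite cD.
    have -> : D :\: P = D :&: (V :\: P).
      by rewrite finset.setIDA (finset.setIidPl sDV).
    case: (leqP 2 #|D :&: P|) => [? _|? ?]; first by exists P; [left|].
    by exists (V :\: P); [right|lia].
  have [||F [_ sF cF]] := @ex_card_between T finset.set0 (D :&: B) 2.
  - exact: finset.sub0set.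
  - by rewrite cards0.
  move: sF; rewrite finset.subsetI => /andP[sFD sFB].
  by exists F => //; apply: (pairsU B) => //; rewrite inE sFB cF.
- move=> E sEV [/eqP/cards1P[x eE]]; subst E.
  have [B eB xB] : exists2 B, B = P \/ B = V :\: P & x \in B.
    by apply: in_part; rewrite -finset.sub1set.
  have [||F [sxF sFB cF]] := @ex_card_between T [set x] B 2.
  - by rewrite finset.sub1set.
  - by rewrite cards1; case: eB => ->; rewrite ?cP ?cQ; lia.
  by exists F => //; apply: (pairsU B) => //; rewrite inE sFB cF.
apply: (@leq_trans (2 * ('C(#|V|./2, 2) + 'C(#|V| - #|V|./2, 2)))).
  rewrite leq_mul2l /= -cQ -[in 'C(_./2, 2)]cP -!cards_draws.
  exact: leq_card_setU.
exact: bin2_halves.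
Qed.

(** Complementation in [V] reverses inclusions and sends sizes [e + 1] and [e - 1] to [d - 1] and
    [d + 1], so the two covering conditions change places. *)
Lemma perfect_dual V d e A : d + e = #|V| -> 0 < d ->
  perfect V d A -> perfect V e [set V :\: F | F in A].
Proof.
move=> de d0 pA; have [_ upA loA] := pA; split.
- apply/fintype.subsetP=> _ /imsetP[F FA ->]; have [sF cF] := perfect_mem pA FA.
  by rewrite inE finset.subsetDl cardsDS // cF; apply/eqP; lia.
- move=> D sD cD; have cE := cardsDS sD; have lD := fintype.subset_leq_card sD.
  have [||F FA sF] := loA (V :\: D); [exact: finset.subsetDl|lia|].
  exists (V :\: F); first exact: imset_f.
  by move: sF; rewrite !finset.subDset finset.setUC.
- move=> E sE cE; have cD := cardsDS sE; have lE := fintype.subset_leq_card sE.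
  have [||F FA sF] := upA (V :\: E); [exact: finset.subsetDl|lia|].
  exists (V :\: F); first exact: imset_f.
  move: sF; rewrite !finset.subsetD sE => /andP[_]; by rewrite disjoint_sym.
Qed.

(** A set avoiding [x] is handled by [A1]; for a set containing [x], delete [x], apply [A2] and put
    [x] back. *)
Lemma perfect_pascal V x d A1 A2 : x \in V -> 0 < d ->
    perfect (V :\ x) d.+1 A1 -> perfect (V :\ x) d A2 ->
  perfect V d.+1 (A1 :|: [set x |: F | F in A2]).
Proof.
move=> xV d0 p1 p2; have [_ up1 lo1] := p1; have [_ up2 lo2] := p2; split.
- apply/fintype.subsetP=> F; rewrite !inE => /orP[/(perfect_mem p1)[sF ->]|].
    by rewrite eqxx (fintype.subset_trans sF) ?finset.subsetDl.
  case/imsetP=> F' /(perfect_mem p2)[]; rewrite finset.subsetD1 => /andP[sF xF] cF ->.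
  by rewrite finset.subUset finset.sub1set xV sF cardsU1 xF cF eqxx.
- move=> D sD cD; have [xD|xD] := boolP (x \in D); last first.
    have [||F F1 sF] := up1 D => //; first by rewrite finset.subsetD1 sD.
    by exists F => //; rewrite inE F1.
  have [||F F2 sF] := up2 (D :\ x); first exact: finset.setSD.
    by have := cardsD1 x D; rewrite xD cD; lia.
  exists (x |: F); first by rewrite inE imset_f ?orbT.
  by rewrite finset.subUset finset.sub1set xD (fintype.subset_trans sF) ?finset.subsetDl.
- move=> E sE cE; have [xE|xE] := boolP (x \in E); last first.
    have [||F F1 sF] := lo1 E => //; first by rewrite finset.subsetD1 sE.
    by exists F => //; rewrite inE F1.
  have [||F F2 sF] := lo2 (E :\ x); first exact: finset.setSD.
    by have := cardsD1 x E; rewrite xE; lia.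
  exists (x |: F); first by rewrite inE imset_f ?orbT.
  by rewrite -(finset.setD1K xE) finset.setUS.
Qed.

Lemma perfect_half V d : 2 <= d -> d + 2 <= #|V| ->
  exists2 A, perfect V d A & 2 * #|A| <= 'C(#|V|, d).
Proof.
have [n] := ubnP #|V|; elim: n V d => // n IHn V d; rewrite ltnS => leVn d2 dV.
have [->|ne_d2] := eqVneq d 2; first by apply: perfect_pairs; lia.
have [eV|ne_V] := eqVneq (d + 2) #|V|.
  have [|A pA cA] := @perfect_pairs V; first lia.
  exists [set V :\: F | F in A].
    by apply: (perfect_dual _ _ pA) => //; lia.
  rewrite -bin_sub; last lia.
  have -> : #|V| - d = 2 by lia.
  by apply: leq_trans cA; rewrite leq_mul2l leq_imset_card.
have /card_gt0P[x xV] : 0 < #|V| by lia.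
have cV := cardsD1 x V; rewrite xV in cV.
case: d d2 dV ne_d2 ne_V => // d d2 dV ne_d2 ne_V.
(* As the size is not 2, it can drop by one; as it is not [#|V| - 2], it can be kept after [x] is
   deleted. *)
have [|||A1 p1 c1] := IHn (V :\ x) d.+1; [lia..|].
have [|||A2 p2 c2] := IHn (V :\ x) d; [lia..|].
exists (A1 :|: [set x |: F | F in A2]); first by apply: perfect_pascal => //; lia.
rewrite cV add1n binS; apply: leq_trans (leq_add c1 c2).
rewrite -mulnDr leq_mul2l /= (leq_trans (leq_card_setU _ _)) //.
by rewrite leq_add2l leq_imset_card.
Qed.

Lemma perfect_exactly_half V d : 2 <= d -> d + 2 <= #|V| -> 2 %| 'C(#|V|, d) ->
  exists2 A, perfect V d A & 2 * #|A| = 'C(#|V|, d).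
Proof.
move=> d2 dV /dvdnP[h eh]; have [A pA cA] := perfect_half d2 dV.
have [sA _ _] := pA.
(* Interpolation one level up: a family of exactly [h] members lies between [A] and the family of
   all [d]-subsets. *)
have [|A' [sAA' sA' cA']] := @ex_card_between _ _ _ h sA.
  by rewrite cards_draws; lia.
by exists A'; [apply: perfect_sup pA sAA' sA'|lia].
Qed.

End PerfectFamilies.

(** * Square-free monomial ideals and the supports of their generators *)

Section SquarefreeIdeals.
Variables (K : fieldType) (n : nat).
Local Notation S := {mpoly K[n]}.
Local Notation mon := 'X_{1..n}.
Implicit Types (I : set S) (B F : {set 'I_n}) (A : {set {set 'I_n}}).

Definition set_mon B : mon := [multinom (i \in B : nat) | i < n].

Lemma set_mon_squarefree B : squarefree (set_mon B).
Proof. by apply/forallP=> i; rewrite mnmE leq_b1. Qed.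

Lemma sigma_set_mon B : sigma (set_mon B) = B.
Proof. by apply/setP=> i; rewrite inE mnmE; case: (i \in B). Qed.

Lemma squarefreeE (m : mon) i : squarefree m -> m i = (i \in sigma m).
Proof. by move/forallP/(_ i); rewrite inE; case: (m i) => [|[]]. Qed.

Lemma squarefree_lepm (m g : mon) :
  squarefree m -> (m <= g)%MM = (sigma m \subset sigma g).
Proof.
move=> sm; apply/mnm_lepP/fintype.subsetP=> h i.
  by have := h i; rewrite !inE; lia.
rewrite (squarefreeE _ sm); case: (boolP (i \in sigma m)) => // /h.
by rewrite inE.
Qed.

Lemma mdeg_squarefree (m : mon) : squarefree m -> mdeg m = #|sigma m|.
Proof.
move=> sm; rewrite mdegE -sum1_card [RHS]big_mkcond /=.
by apply: eq_bigr => i _; rewrite (squarefreeE _ sm); case: (i \in _).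
Qed.

Lemma squarefree_sigma_inj (m g : mon) :
  squarefree m -> squarefree g -> sigma m = sigma g -> m = g.
Proof.
by move=> sm sg e; apply/mnmP=> i; rewrite !(squarefreeE _) ?e.
Qed.

Definition gen_supports I : {set {set 'I_n}} :=
  [set F : {set 'I_n} | `[< exists2 u, mingens I u & F = sigma u >]].

Lemma gen_supportsP I F :
  reflect (exists2 u, mingens I u & F = sigma u) (F \in gen_supports I).
Proof. by rewrite inE; apply: asboolP. Qed.

(** A minimal generator is a multiple of some member of a square-free generating set, and minimality
    makes the two equal. *)
Lemma mingens_squarefree I u :
  squarefree_monomial_ideal I -> mingens I u -> squarefree u.
Proof.
case=> H [sH ->] [G [/minimal_generatingE-> []]].
case/monomial_idealP=> h Hh le_hu /(_ h) <- //; first exact: sH.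
by apply/monomial_idealP; exists h; rewrite ?lepm_refl.
Qed.

Lemma mem_idealX I (g : mon) : squarefree_monomial_ideal I ->
  I 'X_[g] <-> exists2 u, mingens I u & (u <= g)%MM.
Proof.
by move=> sI; have [e _] := mingensP sI; rewrite -{1}e; apply: monomial_idealP.
Qed.

Lemma mem_facet_complex I B :
  (B \in facet_complex I) = [exists F in gen_supports I, B \subset F].
Proof.
rewrite inE; apply/asboolP/exists_inP=> [[u [Iu sBu]]|[F]].
  by exists (sigma u) => //; apply/gen_supportsP; exists u.
by case/gen_supportsP=> u Iu -> sBu; exists u.
Qed.

(** Divisibility of square-free monomials is inclusion of supports, so the monomial of [B] lies
    outside [I] exactly when no generator support lies in [B]. *)
Lemma mem_SR_complex I B : squarefree_monomial_ideal I ->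
  (B \in SR_complex I) = ~~ [exists F in gen_supports I, F \subset B].
Proof.
move=> sI; rewrite inE; apply/asboolP/idP => [|/exists_inP nF].
  case=> g [sg nIg ->]; apply/exists_inP=> -[F /gen_supportsP[u Iu ->] sug]; apply: nIg.
  apply/(mem_idealX _ sI); exists u => //.
  by rewrite squarefree_lepm // (mingens_squarefree sI).
exists (set_mon B); split; rewrite ?sigma_set_mon //.
  exact: set_mon_squarefree.
case/(mem_idealX _ sI) => u Iu; rewrite squarefree_lepm; last first.
  exact: (mingens_squarefree sI).
rewrite sigma_set_mon => sB; apply: nF; exists (sigma u) => //.
by apply/gen_supportsP; exists u.
Qed.

Lemma card_gen_supports I d F :
    squarefree_monomial_ideal I -> of_degree d I ->
  F \in gen_supports I -> #|F| = d.
Proof.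
move=> sI [_ dI] /gen_supportsP[u Iu ->].
by rewrite -mdeg_squarefree ?dI // (mingens_squarefree sI).
Qed.

(** * The f-vectors of an ideal generated in one degree *)

Section UniformDegree.
Variables (I : set S) (d : nat).
Hypothesis sI : squarefree_monomial_ideal I.
Hypothesis dI : forall F, F \in gen_supports I -> #|F| = d.

(** A face of size [d] fills the generator support containing it, both having [d] elements. *)
Lemma fvector_facet_degree : fvector (facet_complex I) d = #|gen_supports I|.
Proof.
apply: eq_card => B; rewrite inE mem_facet_complex.
apply/andP/idP => [[/exists_inP[F FI sBF] /eqP cB]|BI].
  suff -> : B = F by [].
  by apply/eqP; rewrite eqEcard sBF cB (dI FI) /=.
by rewrite (dI BI) eqxx; split=> //; apply/exists_inP; exists B.
Qed.

Lemma fvector_SR_degree :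
  fvector (SR_complex I) d = 'C(n, d) - #|gen_supports I|.
Proof.
rewrite -[in 'C(n, d)](card_ord n) -card_draws -cardsDS; last first.
  by apply/fintype.subsetP=> F /dI cF; rewrite inE cF.
apply: eq_card => B; rewrite [LHS]inE (mem_SR_complex _ sI) finset.in_setD [X in _ = _ && X]inE.
case: eqP => [cB|]; rewrite ?andbF // !andbT; congr (~~ _).
apply/exists_inP/idP => [[F FI sFB]|BI]; last by exists B.
suff <- : F = B by [].
by apply/eqP; rewrite eqEcard sFB cB (dI FI) /=.
Qed.

(** For [k < d] both complexes contain every [k]-set, for [k > d] neither contains any; each time
    one complex needs only a comparison of sizes and the other a covering condition. *)
Lemma fvector_facet_perfect k : perfect [set: 'I_n] d (gen_supports I) ->
  k != d -> d <= n -> fvector (facet_complex I) k = fvector (SR_complex I) k.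
Proof.
move=> [_ upI loI] ne_kd ledn; apply: eq_card => B.
rewrite [LHS]inE [RHS]inE mem_facet_complex mem_SR_complex //.
case: eqP => [cB|]; rewrite ?andbF // !andbT.
have [lt_kd|lt_dk|e] := ltngtP k d; last by rewrite e eqxx in ne_kd.
  transitivity true; last first.
    apply/esym/exists_inP=> -[F FI /fintype.subset_leq_card].
    by rewrite (dI FI); lia.
  (* [B] is first enlarged to size [d - 1], where the lower cover applies. *)
  have [||E [sBE _ cE]] := @ex_card_between _ B [set: 'I_n] d.-1.
  - exact: finset.subsetT.
  - by rewrite cardsT card_ord; lia.
  have [||F FI sEF] := loI E; [exact: finset.subsetT|lia|].
  by apply/exists_inP; exists F => //; apply: fintype.subset_trans sEF.
transitivity false.
  apply/exists_inP=> -[F FI /fintype.subset_leq_card].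
  by rewrite (dI FI); lia.
apply/esym/negbTE; rewrite negbK.
have [||D [_ sDB cD]] := @ex_card_between _ finset.set0 B d.+1.
- exact: finset.sub0set.
- by rewrite cards0 cB.
have [||F FI sFD] := upI D => //.
by apply/exists_inP; exists F => //; apply: fintype.subset_trans sDB.
Qed.

End UniformDegree.

(** * The ideal generated by a family of sets *)

Definition facet_gens A : set mon := fun m => squarefree m /\ sigma m \in A.

Definition facet_ideal A : set S := monomial_ideal (facet_gens A).

Lemma facet_ideal_squarefree A :
  squarefree_monomial_ideal (facet_ideal A).
Proof. by exists (facet_gens A); split=> // m []. Qed.

Lemma mingens_facet_ideal A d : (forall F, F \in A -> #|F| = d) ->
  mingens (facet_ideal A) = facet_gens A.
Proof.
move=> dA; have sI := facet_ideal_squarefree A.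
apply: (minimal_generating_unique sI (mingensP sI)).
split=> // G' sG' IG'; apply/seteqP; split=> // m Gm.
have : facet_ideal A 'X_[m].
  by apply/monomial_idealP; exists m; rewrite ?lepm_refl.
rewrite -IG' => /monomial_idealP[g G'g].
have [[sm Am] [sg Ag]] := (Gm, sG' _ G'g); rewrite squarefree_lepm // => sgm.
suff <- : g = m by [].
apply: squarefree_sigma_inj => //.
by apply/eqP; rewrite eqEcard sgm !dA /=.
Qed.

Lemma gen_supports_facet_ideal A d : (forall F, F \in A -> #|F| = d) ->
  gen_supports (facet_ideal A) = A.
Proof.
move=> dA; apply/setP=> F; apply/gen_supportsP/idP.
  by rewrite (mingens_facet_ideal dA) => -[u [_ Au] ->].
move=> FA; exists (set_mon F); rewrite ?sigma_set_mon //.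
rewrite (mingens_facet_ideal dA); split; rewrite ?sigma_set_mon //.
exact: set_mon_squarefree.
Qed.

Lemma facet_ideal_degree A d :
    (forall F, F \in A -> #|F| = d) -> A != finset.set0 ->
  of_degree d (facet_ideal A).
Proof.
move=> dA /finset.set0Pn[F FA]; split; last first.
  move=> u; rewrite (mingens_facet_ideal dA) => -[su Au].
  by rewrite mdeg_squarefree ?dA.
exists 'X_[set_mon F]; last by rewrite -msupp_eq0 msuppX.
apply/monomial_idealP; exists (set_mon F); rewrite ?lepm_refl //.
by split; rewrite ?sigma_set_mon // set_mon_squarefree.
Qed.

End SquarefreeIdeals.

Arguments facet_ideal K {n} A.

(** * Existence and parity *)

Local Open Scope classical_set_scope.

Theorem corollary3p10 (K : fieldType) (n d : nat) :
  (2 <= d)%N -> (d + 2 <= n)%N ->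
  (V K n d !=set0 <-> (2 %| 'C(n, d))%N).
Proof.
move=> d2 dn; split=> [[I [[sI fI] dI]]|].
  have cI F := card_gen_supports (F := F) sI dI.
  have := fI d; rewrite fvector_facet_degree // fvector_SR_degree // => e.
  (* With this bound the subtraction in [e] is a true one, and [e] reads
     [2 * #|gen_supports I| = 'C(n, d)]. *)
  have : (#|gen_supports I| <= 'C(n, d))%N.
    rewrite -[X in 'C(X, _)](card_ord n) -card_draws subset_leq_card //.
    by apply/fintype.subsetP=> F /cI cF; rewrite inE cF.
  move=> le; apply/dvdnP; exists #|gen_supports I|; lia.
have [cT d2n] : #|[set: 'I_n]%SET| = n /\ (d <= n)%N.
  by rewrite cardsT card_ord; split; lia.
rewrite -[X in 'C(X, _)]cT => ev.
have [||A pA cA] := @perfect_exactly_half _ [set: 'I_n]%SET d _ _ ev => //.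
  by rewrite cT.
rewrite cT in cA; have dA F : F \in A -> #|F| = d by case/(perfect_mem pA).
have sI := facet_ideal_squarefree K A.
have gA := gen_supports_facet_ideal K dA.
have dI F : F \in gen_supports (facet_ideal K A) -> #|F| = d.
  by rewrite gA; apply: dA.
exists (facet_ideal K A); split; last first.
  (* The ideal is nonzero because [A], being half of a positive binomial in size, has a member. *)
  apply: facet_ideal_degree => //; apply/eqP=> A0.
  by have := bin_gt0 n d; rewrite -cA A0 cards0 d2n.
(* Perfection settles every entry except [k = d], where the size of [A] decides. *)
split=> // k; have [->|ne_kd] := eqVneq k d; last first.
  by apply: (fvector_facet_perfect sI dI) => //; rewrite gA.
rewrite (fvector_facet_degree dI) (fvector_SR_degree sI dI) gA -cA.
lia.
Qed.
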